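(* Let $(X,d)$ be a proper metric space, $f:X\to X$ continuous, $x_0\in X$ and $1\le p<\infty$. Then the push-forward $f_*\mu=\mu\circ f^{-1}$ maps $\mathcal P_p(X)$ into itself and is continuous with respect to $w_p$ if and only if \[ \sup_{x\in X}\frac{d(f(x),x_0)}{1+d(x,x_0)}<\infty. \]
   Context: A metric space is proper if closed bounded sets are compact. $\mathcal P_p(X)$ is the set of Borel probability measures with finite $p$-th moment $\int d(x,x_0)^p\,d\mu<\infty$. It carries the $L^p$-Wasserstein distance \[ w_p(\mu,\nu)=\Big(\inf_{\pi\in\Pi(\mu,\nu)}\int d(x,y)^p\,d\pi\Big)^{1/p}. \] *)

(* Defs.v *)
From HB Require Import structures.
From mathcomp Require Import all_boot all_order all_algebra.
From mathcomp Require Import all_classical all_reals all_analysis.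
Set Implicit Arguments. Unset Strict Implicit. Unset Printing Implicit Defensive.
Import Order.TTheory GRing.Theory Num.Theory.
Local Open Scope classical_set_scope.
Local Open Scope ring_scope.

Section MetricDefs.
Context {R : realType} {X : pointedType} (dist : X -> X -> R).

Definition is_metric : Prop :=
  [/\ forall x y, 0 <= dist x y,
      forall x y, dist x y = 0 <-> x = y,
      forall x y, dist x y = dist y x &
      forall x y z, dist x z <= dist x y + dist y z].

Definition mball (x : X) (r : R) : set X := [set y | dist x y < r].

Definition mopen (A : set X) : Prop :=
  forall x, A x -> exists2 e : R, 0 < e & mball x e `<=` A.

Definition mclosed (A : set X) : Prop := mopen (~` A).

Definition mbounded (A : set X) : Prop := exists x r, A `<=` mball x r.

Definition mcompact (A : set X) : Prop :=
  forall (I : Type) (F : I -> set X), (forall i, mopen (F i)) ->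
    A `<=` \bigcup_i F i ->
    exists2 D : set I, finite_set D & A `<=` \bigcup_(i in D) F i.

Definition proper_space : Prop :=
  forall A, mclosed A -> mbounded A -> mcompact A.

Definition mcontinuous (f : X -> X) : Prop :=
  forall x (e : R), 0 < e -> exists2 d : R, 0 < d &
    forall y, dist x y < d -> dist (f x) (f y) < e.

Definition Borel : Type := g_sigma_algebraType mopen.

Local Open Scope ereal_scope.

Definition Pp (p : R) (x0 : X) (mu : probability Borel R) : Prop :=
  \int[mu]_x ((dist x x0) `^ p)%:E < +oo.

Definition coupling (mu nu : probability Borel R)
  (pi : probability (Borel * Borel)%type R) : Prop :=
  (forall A : set Borel, measurable A -> pi (fst @^-1` A) = mu A) /\
  (forall A : set Borel, measurable A -> pi (snd @^-1` A) = nu A).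

Definition wasserstein (p : R) (mu nu : probability Borel R) : \bar R :=
  (ereal_inf [set \int[pi]_z ((dist z.1 z.2) `^ p)%:E
             | pi in [set pi | coupling mu nu pi]]) `^ p^-1.

Definition is_push (f : X -> X) (mu nu : probability Borel R) : Prop :=
  forall A : set Borel, measurable A -> nu A = mu (f @^-1` A).

Definition push_Pp_continuous (p : R) (x0 : X) (f : X -> X) : Prop :=
  (forall mu : probability Borel R, Pp p x0 mu ->
     exists2 nu : probability Borel R, is_push f mu nu & Pp p x0 nu) /\
  (forall mu mu' : probability Borel R, Pp p x0 mu -> is_push f mu mu' ->
   forall e : R, (0 < e)%R -> exists2 d : R, (0 < d)%R &
     forall nu nu' : probability Borel R, Pp p x0 nu -> is_push f nu nu' ->
       wasserstein p mu nu < d%:E -> wasserstein p mu' nu' < e%:E).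

End MetricDefs.

(* Main.v *)
Require Import Defs.
From HB Require Import structures.
From mathcomp Require Import all_boot all_order all_algebra.
From mathcomp Require Import all_classical all_reals all_analysis.
From mathcomp Require Import measurable_realfun lra.
Import Order.TTheory GRing.Theory Num.Theory.
Local Open Scope classical_set_scope.
Local Open Scope ring_scope.

(** If [f] has linear growth, a nearly optimal coupling of [mu] and [nu] is pushed forward by
    [(f, f)]. Its new cost is bounded pointwise by
      [e + A * d(x,y)^p + B * (1 + d(x,x0))^p 1_{d(x,x0) > r}],
    where [B] depends only on the growth constant and [A] on [e] and [r] through the uniform
    continuity of [f] on the closed [r]-ball; the last term is the tail of a [mu]-integrable
    function, so it is small for large [r] whatever [nu] is.
    Conversely, moving mass [t = (c / (1 + d(x,x0)))^p] of the Dirac mass at [x0] to [x] costs less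
    than [c] in [w_p], uniformly in [x]; continuity at that Dirac mass then bounds
    [t^(1/p) * d(f x0, f x)], which is the growth condition. *)

(** * Real powers, finite minima and push-forward of probabilities *)

Lemma powR_le_mono (R : realType) (p a b : R) :
  0 <= p -> 0 <= a -> a <= b -> a `^ p <= b `^ p.
Proof.
move=> p0 a0 ab; apply: ge0_ler_powR => //; rewrite nnegrE //.
exact: le_trans ab.
Qed.

Lemma powRK (R : realType) (p a : R) : 0 < p -> 0 <= a -> (a `^ p^-1) `^ p = a.
Proof. by move=> p0 a0; rewrite -powRrM mulVf ?gt_eqF// powRr1. Qed.

Lemma powRVK (R : realType) (p a : R) : 0 < p -> 0 <= a -> (a `^ p) `^ p^-1 = a.
Proof. by move=> p0 a0; rewrite -powRrM divff ?gt_eqF// powRr1. Qed.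

(** The sum is at most twice the larger term, and the power of the larger term is one of the two
    summands on the right. The crude constant [2 ^ p] suffices, since only finiteness and uniformity
    of constants matter later. *)
Lemma powRD_le (R : realType) (p a b : R) : 0 <= p -> 0 <= a -> 0 <= b ->
  (a + b) `^ p <= 2 `^ p * (a `^ p + b `^ p).
Proof.
move=> p0 a0 b0; rewrite mulrDr -!powRM//.
have [ab|/ltW ba] := leP a b.
  apply: (@le_trans _ _ ((2 * b) `^ p)); last by rewrite lerDr powR_ge0.
  by apply: powR_le_mono => //; lra.
apply: (@le_trans _ _ ((2 * a) `^ p)); last by rewrite lerDl powR_ge0.
by apply: powR_le_mono => //; lra.
Qed.

Lemma seq_lower_bound (R : realDomainType) (T : eqType) (h : T -> R) (s : seq T) :
  (forall x, 0 < h x) -> exists2 d, 0 < d & {in s, forall x, d <= h x}.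
Proof.
move=> h0; elim: s => [|a s [d d0 ds]]; first by exists 1.
exists (Num.min d (h a)); first by rewrite lt_min d0 h0.
move=> x; rewrite inE => /predU1P[->|/ds dx]; first by rewrite ge_min lexx orbT.
by rewrite ge_min dx.
Qed.

Lemma exists_invS_lt (R : realType) (e : R) :
  0 < e -> exists n : nat, n.+1%:R^-1 < e.
Proof.
move=> e0; exists (Num.bound e^-1); rewrite invf_plt ?posrE//.
have := archi_boundP (_ : 0 <= e^-1); rewrite invr_ge0 (ltW e0) => /(_ isT).
by move=> /lt_trans; apply; rewrite ltr_nat.
Qed.

(** Change of variables for a [nu] that is known only through its values on measurable sets, as
    [is_push] and [coupling] provide it. *)
Lemma ge0_integral_push (R : realType) (d d' : measure_display)
  (T : measurableType d) (T' : measurableType d') (phi : T -> T')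
  (mu : probability T R) (nu : probability T' R) (g : T' -> \bar R) :
  measurable_fun [set: T] phi ->
  (forall A, measurable A -> nu A = mu (phi @^-1` A)) ->
  measurable_fun [set: T'] g -> (forall y, (0 <= g y)%E) ->
  (\int[nu]_y g y = \int[mu]_x g (phi x))%E.
Proof.
move=> mphi numu mg g0.
rewrite (eq_measure_integral
  (measure_function_pushforward__canonical__measure_function_Measure mu mphi)); last first.
  by move=> A mA _; exact: numu.
by rewrite ge0_integral_pushforward.
Qed.

Lemma exists_push (R : realType) (d d' : measure_display)
  (T : measurableType d) (T' : measurableType d') (phi : T -> T')
  (mu : probability T R) : measurable_fun [set: T] phi ->
  exists nu : probability T' R, forall A, nu A = mu (phi @^-1` A).
Proof.
move=> mphi; pose F : {mfun T >-> T'} := HB.pack phi (isMeasurableFun.Build _ _ _ _ phi mphi).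
by exists (distribution mu F).
Qed.

(** * Measurability and compactness in a proper metric space *)

Section Metric.
Context {R : realType} {X : pointedType} (dist : X -> X -> R).
Hypothesis dist_metric : is_metric dist.

Let dist_ge0 x y : 0 <= dist x y. Proof. by case: dist_metric. Qed.
Let distxx x : dist x x = 0.
Proof. by case: dist_metric => _ d0 _ _; apply/d0. Qed.
Let dist_sym x y : dist x y = dist y x. Proof. by case: dist_metric. Qed.
Let dist_tri y x z : dist x z <= dist x y + dist y z.
Proof. by case: dist_metric. Qed.

Lemma mball_mopen x r : mopen dist (mball dist x r).
Proof.
move=> y; rewrite /mball /= => xy; exists (r - dist x y); first by rewrite subr_gt0.
by move=> z /= yz; have := dist_tri y x z; lra.
Qed.

Lemma mclosed_le x r : mclosed dist [set y | dist x y <= r].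
Proof.
move=> y /= /negP; rewrite -ltNge => xy.
exists (dist x y - r); first by rewrite subr_gt0.
move=> z; rewrite /mball /= => yz; apply/negP; rewrite -ltNge.
by have := dist_tri z x y; rewrite (dist_sym z y); lra.
Qed.

Lemma measurable_mopen (A : set (Borel dist)) : mopen dist A -> measurable A.
Proof. by move=> oA; exact: sub_sigma_algebra. Qed.

Lemma measurable_point (x : Borel dist) : measurable [set x].
Proof.
rewrite (_ : [set x] = ~` ~` [set y | dist x y <= 0]).
  by apply: measurableC; apply: measurable_mopen; exact: mclosed_le.
rewrite setCK; apply/seteqP; split => [y ->|y] /=; first by rewrite distxx.
case: dist_metric => _ d0 _ _ le0; apply/esym/d0/le_anti.
by rewrite le0 dist_ge0.
Qed.

Lemma mcontinuous_measurable (f : X -> X) : mcontinuous dist f ->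
  measurable_fun [set: Borel dist] (f : Borel dist -> Borel dist).
Proof.
move=> cf; apply: (@measurability _ _ (Borel dist) (Borel dist) setT f (mopen dist)) => // _ [A oA <-].
rewrite setTI; apply: measurable_mopen => x /= /oA[e e0 eA].
have [d d0 dP] := cf x e e0; exists d => // y xy.
by apply: eA; exact: dP.
Qed.

Hypothesis dist_proper : proper_space dist.

Lemma closed_ball_compact x r : mcompact dist [set y | dist x y <= r].
Proof.
apply: dist_proper; first exact: mclosed_le.
by exists x, (r + 1) => y; rewrite /mball /=; lra.
Qed.

(** Compactness of the closed ball, with radii that may vary with the centre: constant radii give
    separability, moduli of continuity give uniform continuity. *)
Lemma finite_net x r (h : X -> R) : (forall y, 0 < h y) ->
  exists s : seq X, forall y, dist x y <= r ->
    exists2 c, c \in s & dist c y < h c.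
Proof.
move=> h0.
have [|y _|D /finite_seqP[s ->] sP] :=
    closed_ball_compact x r X (fun y => mball dist y (h y)).
- by move=> y; exact: mball_mopen.
- by exists y => //; rewrite /mball /= distxx.
by exists s => y /sP[c cs cy]; exists c.
Qed.

(** The space is the union of the closed balls of integer radius, each of which has a finite net at
    every scale; these countably many finite nets together are dense. *)
Lemma proper_separable (x : X) :
  exists q : nat -> X, forall y e, 0 < e -> exists n, dist (q n) y < e.
Proof.
have /choice[s sP] : forall Nk : nat * nat, exists s : seq X, forall y,
    dist x y <= Nk.1%:R -> exists2 c, c \in s & dist c y < Nk.2.+1%:R^-1.
  by case=> N k; apply: (finite_net x N%:R (fun=> k.+1%:R^-1)).
(* The index [n] codes a radius, a scale and a position in the corresponding net; codes of no
   triple, and positions past the end of a net, give the harmless value [x]. *)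
exists (fun n => if @unpickle (nat * nat * nat)%type n is Some t
                 then nth x (s t.1) t.2 else x) => y e e0.
pose N := Num.bound (dist x y); have [k ke] := exists_invS_lt _ _ e0.
have [|c cs cy] := sP (N, k) y; first exact/ltW/archi_boundP/dist_ge0.
exists (pickle ((N, k), index c (s (N, k)))); rewrite pickleK /= nth_index//.
exact: lt_trans ke.
Qed.

(** The product carries the product of the Borel sigma-algebras, so openness of [dist z.1 z.2 < r]
    is not enough: the set must be a countable union of measurable rectangles. Separability provides
    one, with rectangles made of two balls around a common centre [q n]. *)
Lemma measurable_dist :
  measurable_fun [set: Borel dist * Borel dist] (fun z : Borel dist * Borel dist => dist z.1 z.2).
Proof.
have [q qP] := proper_separable point.
apply: (measurability _ (RGenInftyO.measurableE R)) => //= _ [_ [r ->] <-].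
rewrite setTI (_ : _ @^-1` _ = \bigcup_n \bigcup_m
   (fst @^-1` (mball dist (q n) m.+1%:R^-1 : set (Borel dist)) `&`
    snd @^-1` (mball dist (q n) (r - m.+1%:R^-1) : set (Borel dist)))).
  apply: bigcupT_measurable => n; apply: bigcupT_measurable => m.
  apply: measurableI; rewrite -[X in measurable X]setTI.
    by apply: measurable_fst => //; apply: measurable_mopen; exact: mball_mopen.
  by apply: measurable_snd => //; apply: measurable_mopen; exact: mball_mopen.
apply/seteqP; split => -[a b] /=; rewrite ?in_itv/=.
  (* With [c] below half the gap and [dist (q n) a < c], the triangle inequality gives
     [dist (q n) b < c + dist a b < r - c]. *)
  move=> abr; have [|m mr] := exists_invS_lt _ ((r - dist a b) / 2).
    by rewrite divr_gt0// subr_gt0.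
  have m0 : 0 < (m.+1%:R^-1 : R) by rewrite invr_gt0.
  have [n qn] := qP a _ m0; exists n => //; exists m => //; split => //=.
  rewrite /mball /=; have := dist_tri a (q n) b.
  by move: (m.+1%:R^-1) mr qn => c; lra.
move=> [n _ [m _ []]]; rewrite /mball /=; move: (m.+1%:R^-1) => c qa qb.
by have := dist_tri (q n) a b; rewrite (dist_sym a (q n)); lra.
Qed.

(** A Lebesgue number argument in which only [y] is confined to the ball. The net uses half the
    local moduli and [d] is at most each of these halves, so [y] and [z] both lie within the full
    modulus of one centre [c]. *)
Lemma uniform_continuity_ball (f : X -> X) x r e : mcontinuous dist f -> 0 < e ->
  exists2 d, 0 < d & forall y z, dist x y <= r -> dist y z < d ->
    dist (f y) (f z) < e.
Proof.
move=> cf e0; have e20 : 0 < e / 2 by rewrite divr_gt0.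
have /choice[h hP] : forall y, exists d, 0 < d /\
    forall z, dist y z < d -> dist (f y) (f z) < e / 2.
  by move=> y; have [d d0 dP] := cf y _ e20; exists d.
have h20 y : 0 < h y / 2 by rewrite divr_gt0//; case: (hP y).
have [s sP] := finite_net x r _ h20.
have [d d0 dP] := seq_lower_bound _ _ _ s h20.
exists d => // y z xy yz; have [c cs cy] := sP y xy.
have [hc0 fc] := hP c; have /dP dh := cs.
have fcy : dist (f c) (f y) < e / 2 by apply: fc; lra.
have fcz : dist (f c) (f z) < e / 2.
  by apply: fc; have := dist_tri y c z; lra.
by have := dist_tri (f c) (f y) (f z); rewrite (dist_sym (f y) (f c)); lra.
Qed.

End Metric.

(** * Integrals of affine cost bounds, and removal of the root in the distance *)

Lemma integral_comb (R : realType) (d : measure_display) (T : measurableType d)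
  (mu : probability T R) (a b c : R) (u v : T -> R) :
  0 <= a -> 0 <= b -> 0 <= c ->
  measurable_fun [set: T] u -> measurable_fun [set: T] v ->
  (forall x, 0 <= u x) -> (forall x, 0 <= v x) ->
  (\int[mu]_x (a + b * u x + c * v x)%:E =
   a%:E + b%:E * \int[mu]_x (u x)%:E + c%:E * \int[mu]_x (v x)%:E)%E.
Proof.
move=> a0 b0 c0 mu_ mv u0 v0.
have mb : measurable_fun [set: T] (fun x => (b * u x)%:E).
  by apply/measurable_EFinP; exact: measurable_funM.
have mc : measurable_fun [set: T] (fun x => (c * v x)%:E).
  by apply/measurable_EFinP; exact: measurable_funM.
under eq_integral do rewrite EFinD.
rewrite ge0_integralD//; last 3 first.
- by move=> x _; rewrite lee_fin addr_ge0// mulr_ge0.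
- apply/measurable_EFinP/measurable_funD => //; exact: measurable_funM.
- by move=> x _; rewrite lee_fin mulr_ge0.
under eq_integral do rewrite EFinD.
rewrite ge0_integralD//; last by move=> x _; rewrite lee_fin mulr_ge0.
rewrite integral_cst//= probability_setT mule1.
under eq_integral do rewrite EFinM.
rewrite ge0_integralZl_EFin//; [|by move=> x _; rewrite lee_fin|exact/measurable_EFinP].
congr (_ + _)%E; under eq_integral do rewrite EFinM.
by rewrite ge0_integralZl_EFin//; [move=> x _; rewrite lee_fin|exact/measurable_EFinP].
Qed.

Lemma poweR_lt_fin (R : realType) (p e : R) (x : \bar R) :
  0 < p -> 0 < e -> (0 <= x)%E -> ((x `^ p^-1 < e%:E) <-> (x < (e `^ p)%:E))%E.
Proof.
move=> p0 e0; have pV0 : 0 < p^-1 by rewrite invr_gt0.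
case: x => [r| |] // r0; last first.
  by rewrite poweRyr ?gt_eqF//; split => //; rewrite !ltNge !leey.
rewrite poweR_EFin !lte_fin; rewrite lee_fin in r0; split => re.
  rewrite -[r](@powRK _ p)//; apply: gt0_ltr_powR; rewrite ?nnegrE ?powR_ge0//.
  exact: ltW.
rewrite -[e](@powRVK _ p) ?(ltW e0)//.
by apply: gt0_ltr_powR; rewrite ?nnegrE ?powR_ge0.
Qed.

(** * Couplings, tails of the moment and the pointwise cost bound *)

Section Wasserstein.
Context {R : realType} {X : pointedType} (dist : X -> X -> R).
Hypothesis dist_metric : is_metric dist.

Let dist_ge0 x y : 0 <= dist x y. Proof. by case: dist_metric. Qed.
Let dist_sym x y : dist x y = dist y x. Proof. by case: dist_metric. Qed.
Let dist_tri y x z : dist x z <= dist x y + dist y z.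
Proof. by case: dist_metric. Qed.

(** A strict bound on an infimum is witnessed by some coupling, so no optimal coupling has to
    exist. *)
Lemma wasserstein_ltP p e (mu nu : probability (Borel dist) R) :
  0 < p -> 0 < e ->
  (wasserstein p mu nu < e%:E)%E <->
  exists2 pi, coupling mu nu pi &
    (\int[pi]_z (dist z.1 z.2 `^ p)%:E < (e `^ p)%:E)%E.
Proof.
move=> p0 e0; rewrite /wasserstein poweR_lt_fin//; last first.
  by apply: le_ereal_inf_tmp => _ [pi _ <-]; apply: integral_ge0 => z _; rewrite lee_fin powR_ge0.
split=> [/ereal_inf_ltP[_ [pi cpi <-]]|[pi cpi ltpi]]; first by exists pi.
by apply/ereal_inf_ltP; eexists; [exists pi; first exact: cpi; reflexivity|].
Qed.

Lemma coupling_push (f : X -> X) (mu nu mu' nu' : probability (Borel dist) R) pi :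
  mcontinuous dist f -> coupling mu nu pi -> is_push f mu mu' -> is_push f nu nu' ->
  exists2 pi' : probability (Borel dist * Borel dist)%type R, coupling mu' nu' pi' &
    forall A, pi' A =
      pi ((fun z : Borel dist * Borel dist => (f z.1 : Borel dist, f z.2 : Borel dist)) @^-1` A).
Proof.
move=> cf [pi1 pi2] fmu fnu; have mf := mcontinuous_measurable _ _ cf.
have mff : measurable_fun [set: Borel dist * Borel dist]
    (fun z : Borel dist * Borel dist => (f z.1 : Borel dist, f z.2 : Borel dist)).
  apply: measurable_fun_pair; first exact: (measurableT_comp mf measurable_fst).
  exact: (measurableT_comp mf measurable_snd).
have [pi' pi'E] := exists_push _ _ _ _ _ _ pi mff.
exists pi' => //; split=> A mA; rewrite pi'E.
  rewrite fmu// -pi1// -[X in measurable X]setTI; exact: mf.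
rewrite fnu// -pi2// -[X in measurable X]setTI; exact: mf.
Qed.

Hypothesis dist_proper : proper_space dist.

Lemma measurable_dist_point (y : X) :
  measurable_fun [set: Borel dist] (fun x : Borel dist => dist x y).
Proof.
exact: (measurable_fun_pair1 (y : Borel dist) (measurable_dist _ dist_metric dist_proper)).
Qed.

Lemma measurable_powR_comp (d : measure_display) (T : measurableType d) (u : T -> R) p :
  measurable_fun [set: T] u -> measurable_fun [set: T] (fun x => u x `^ p).
Proof. by move=> mu; apply: (measurableT_comp (measurable_powR p)). Qed.

Lemma measurable_growth p (y : X) :
  measurable_fun [set: Borel dist] (fun x : Borel dist => (1 + dist x y) `^ p).
Proof.
apply: measurable_powR_comp; apply: measurable_funD => //.
exact: measurable_dist_point.
Qed.

Lemma Pp_growth p x0 (mu : probability (Borel dist) R) : 0 <= p -> Pp p x0 mu ->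
  (\int[mu]_x ((1 + dist x x0) `^ p)%:E < +oo)%E.
Proof.
move=> p0 Ppmu; have md := measurable_powR_comp _ _ _ p (measurable_dist_point x0).
(* The summand with coefficient [0] only gives the bound the shape expected by [integral_comb]. *)
apply: (@le_lt_trans _ _ (\int[mu]_x (2 `^ p + 2 `^ p * dist x x0 `^ p + 0 * dist x x0 `^ p)%:E)%E).
  apply: ge0_le_integral => //.
  - by move=> x _; rewrite lee_fin powR_ge0.
  - by apply/measurable_EFinP; exact: measurable_growth.
  - apply/measurable_EFinP; apply: measurable_funD; last exact: measurable_funM.
    by apply: measurable_funD => //; exact: measurable_funM.
  - move=> x _; rewrite lee_fin mul0r addr0.
    by apply: le_trans (powRD_le _ _ _ _ p0 ler01 (dist_ge0 x x0)) _; rewrite powR1 mulrDr mulr1.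
rewrite integral_comb ?powR_ge0//; try by move=> x; rewrite powR_ge0.
rewrite mul0e adde0 lte_add_pinfty ?ltry//.
by apply: lte_mul_pinfty; rewrite ?lee_fin ?powR_ge0.
Qed.

Lemma measurable_growth_tail p r (y : X) :
  measurable_fun [set: Borel dist] (fun x : Borel dist =>
    (1 + dist x y) `^ p * \1_[set z : Borel dist | r < dist z y] x).
Proof.
apply: measurable_funM; first exact: measurable_growth.
apply: measurable_indic.
have := measurable_dist_point y measurableT _ (measurable_itv `]r, +oo[).
rewrite setTI; congr measurable; apply/seteqP.
by split => x /=; rewrite in_itv/= andbT.
Qed.

(** Dominated convergence: the integrands are below the integrable growth function, and at each [x]
    they vanish once [n] exceeds [dist x x0]. *)
Lemma integral_growth_tail p x0 (mu : probability (Borel dist) R) e :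
  0 <= p -> Pp p x0 mu -> 0 < e ->
  exists n : nat, (\int[mu]_x ((1 + dist x x0) `^ p *
    \1_[set y : Borel dist | n%:R < dist y x0]%R x)%:E < e%:E)%E.
Proof.
move=> p0 Ppmu e0.
have [|||||_ _] := @dominated_convergence _ _ _ mu setT measurableT
  (fun n x => ((1 + dist x x0) `^ p * \1_[set y : Borel dist | n%:R < dist y x0]%R x)%:E)
  (cst 0%E) (fun x => ((1 + dist x x0) `^ p)%:E).
- by move=> n; apply/measurable_EFinP; exact: measurable_growth_tail.
- exact: measurable_cst.
- apply: aeW => x _; apply: cvg_near_cst; exists (Num.bound (dist x x0)) => // n /= xn.
  rewrite indicE memNset ?mulr0//=; apply/negP; rewrite -leNgt.
  apply/ltW/(lt_le_trans (archi_boundP (dist_ge0 x x0))).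
  by rewrite ler_nat.
- apply/integrableP; split; first by apply/measurable_EFinP; exact: measurable_growth.
  under eq_integral do rewrite gee0_abs ?lee_fin ?powR_ge0//.
  exact: Pp_growth.
- apply: aeW => x n _; rewrite gee0_abs ?lee_fin ?mulr_ge0 ?powR_ge0//.
  by rewrite ler_piMr ?powR_ge0// indicE; case: (_ \in _).
rewrite integral0 => /(_ [set y | (y < e%:E)%E])[].
  have := @open_ereal_lt_ereal R e%:E; rewrite openE => /(_ 0%E); apply.
  by rewrite /= lte_fin.
by move=> n _ /(_ n (leqnn n)) /=; exists n.
Qed.

(** Three regimes. If [dist x x0 > r], linear growth gives the tail term plus a multiple of
    [dist x y ^ p]. Inside the ball, uniform continuity gives [e] when [dist x y < h]; otherwise
    [dist x y] is at least [h] and absorbs the bounded quantity [1 + dist x x0]. *)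
Lemma push_cost_bound f x0 p M r e : mcontinuous dist f -> 0 < p -> 0 < M ->
  (forall x, dist (f x) x0 <= M * (1 + dist x x0)) -> 0 <= r -> 0 < e ->
  exists2 A, 0 < A & forall x y, dist (f x) (f y) `^ p <=
    e + A * dist x y `^ p + 2 `^ p * (2 * M) `^ p *
      ((1 + dist x x0) `^ p * \1_[set y : Borel dist | r < dist y x0]%R x).
Proof.
move=> cf p0 M0 fM r0 e0.
have [|h h0 hP] := uniform_continuity_ball _ dist_metric dist_proper f x0 r (e `^ p^-1) cf.
  exact: powR_gt0.
(* For [dist x x0 <= r] and [h <= dist x y], one has [1 + dist x x0 <= (1 + r) / h * dist x y];
   inserted in [fxy] below, this bounds the image distance by [L * dist x y]. *)
pose L := M * (2 * (1 + r) / h + 1).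
have L0 : 0 < L by rewrite mulr_gt0// addr_gt0// divr_gt0// mulr_gt0//; lra.
exists (L `^ p + 2 `^ p * M `^ p).
  by rewrite addr_gt0 ?mulr_gt0 ?powR_gt0.
move=> x y.
have fxy : dist (f x) (f y) <= M * (2 * (1 + dist x x0) + dist x y).
  have := dist_tri x0 (f x) (f y); rewrite (dist_sym x0 (f y)).
  have : M * (dist y x0) <= M * (dist x y + dist x x0).
    by rewrite ler_pM2l//; have := dist_tri x y x0; rewrite (dist_sym y x).
  by have := fM x; have := fM y; nra.
have A1 : 0 <= L `^ p * dist x y `^ p by rewrite mulr_ge0 ?powR_ge0.
have A2 : 0 <= 2 `^ p * M `^ p * dist x y `^ p by rewrite !mulr_ge0 ?powR_ge0.
rewrite mulrDl; have [rx|xr] := ltP r (dist x x0).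
  rewrite indicE mem_set//= mulr1.
  have d2 : 0 <= 2 * M * (1 + dist x x0) by rewrite !mulr_ge0 ?addr_ge0// ltW.
  have : dist (f x) (f y) `^ p <=
      2 `^ p * ((2 * M * (1 + dist x x0)) `^ p + (M * dist x y) `^ p).
    apply: le_trans (powRD_le _ _ _ _ (ltW p0) d2 (mulr_ge0 (ltW M0) (dist_ge0 x y))).
    by apply: powR_le_mono; rewrite ?(ltW p0)//; apply: (le_trans fxy); lra.
  rewrite powRM ?addr_ge0// ?mulr_ge0 ?(ltW M0)//.
  rewrite (powRM _ (ltW M0))//.
  move: (L `^ p * _) A1 => a A1.
  by rewrite mulrDr !mulrA => /le_trans; apply; lra.
rewrite indicE memNset/= ?mulr0 ?addr0; last by apply/negP; rewrite -leNgt.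
have [xy|xy] := ltP (dist x y) h.
  apply: (@le_trans _ _ e); last by lra.
  rewrite -[leRHS](@powRK _ p)// ?(ltW e0)//.
  apply: powR_le_mono; rewrite ?(ltW p0)//.
  by apply/ltW/hP => //; rewrite dist_sym.
apply: (@le_trans _ _ (L `^ p * dist x y `^ p)); last by lra.
rewrite -powRM ?(ltW L0)//; apply: powR_le_mono; rewrite ?(ltW p0)//.
apply: (le_trans fxy); rewrite /L -[leRHS]mulrA ler_pM2l// [leRHS]mulrDl mul1r lerD2r.
rewrite -[leRHS]mulrA -[leRHS]mulrA ler_pM2l//; apply: (@le_trans _ _ (1 + r)); first lra.
by rewrite ler_peMr ?addr_ge0// mulrC ler_pdivlMr// mul1r.
Qed.

End Wasserstein.

(** * The two implications for the push-forward *)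

Section PushForward.
Context {R : realType} {X : pointedType} (dist : X -> X -> R).
Hypothesis dist_metric : is_metric dist.
Hypothesis dist_proper : proper_space dist.
Context (f : X -> X) (x0 : X) (p : R).
Hypothesis f_continuous : mcontinuous dist f.
Hypothesis p_ge1 : 1 <= p.

Let dist_ge0 x y : 0 <= dist x y. Proof. by case: dist_metric. Qed.
Let distxx x : dist x x = 0.
Proof. by case: dist_metric => _ d0 _ _; apply/d0. Qed.
Let dist_sym x y : dist x y = dist y x. Proof. by case: dist_metric. Qed.
Let dist_tri y x z : dist x z <= dist x y + dist y z.
Proof. by case: dist_metric. Qed.
Let p_gt0 : 0 < p. Proof. exact: lt_le_trans p_ge1. Qed.
Let p_ge0 : 0 <= p. Proof. exact: ltW. Qed.
Let mf : measurable_fun [set: Borel dist] (f : Borel dist -> Borel dist) :=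
  mcontinuous_measurable dist f f_continuous.
Let mdp (y : X) : measurable_fun [set: Borel dist] (fun x : Borel dist => dist x y `^ p) :=
  measurable_powR_comp _ _ _ p (measurable_dist_point _ dist_metric dist_proper y).
Let mcost : measurable_fun [set: Borel dist * Borel dist]
    (fun z : Borel dist * Borel dist => dist z.1 z.2 `^ p) :=
  measurable_powR_comp _ _ _ p (measurable_dist _ dist_metric dist_proper).

Lemma push_Pp M (mu : probability (Borel dist) R) : 0 < M ->
  (forall x, dist (f x) x0 <= M * (1 + dist x x0)) -> Pp p x0 mu ->
  exists2 nu : probability (Borel dist) R, is_push f mu nu & Pp p x0 nu.
Proof.
move=> M0 fM Ppmu; have [nu nuE] := exists_push _ _ _ _ _ _ mu mf.
exists nu; first by move=> A _; rewrite nuE.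
rewrite /Pp (ge0_integral_push _ _ _ _ _ _ mu nu _ mf) =>
  [|A _||y]; last 3 first.
- exact: nuE.
- exact/measurable_EFinP.
- by rewrite lee_fin powR_ge0.
apply: (@le_lt_trans _ _ (\int[mu]_x ((M `^ p)%:E * ((1 + dist x x0) `^ p)%:E)%E)%E).
  apply: ge0_le_integral => //.
  - by move=> x _; rewrite lee_fin powR_ge0.
  - apply: (measurableT_comp _ mf (f := fun y : Borel dist => (dist y x0 `^ p)%:E)).
    exact/measurable_EFinP.
  - apply/measurable_EFinP; apply: measurable_funM => //.
    exact: measurable_growth.
  - move=> x _; rewrite -EFinM lee_fin -powRM ?(ltW M0) ?addr_ge0//.
    exact: powR_le_mono.
rewrite ge0_integralZl_EFin ?powR_ge0//.
- by apply: lte_mul_pinfty; rewrite ?lee_fin ?powR_ge0//; exact: Pp_growth.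
- by move=> x _; rewrite lee_fin powR_ge0.
- by apply/measurable_EFinP; exact: measurable_growth.
Qed.

(** Each of the three terms of [push_cost_bound] contributes at most [E / 4] to the cost of the
    pushed coupling, where [E = e ^ p]. The radius [r], then [A], then [d] are chosen from [mu]
    alone, before [nu] appears. *)
Lemma push_wasserstein_continuous M (mu mu' : probability (Borel dist) R) e : 0 < M ->
  (forall x, dist (f x) x0 <= M * (1 + dist x x0)) ->
  Pp p x0 mu -> is_push f mu mu' -> 0 < e ->
  exists2 d : R, 0 < d & forall nu nu' : probability (Borel dist) R,
    is_push f nu nu' -> (wasserstein p mu nu < d%:E)%E ->
    (wasserstein p mu' nu' < e%:E)%E.
Proof.
move=> M0 fM Ppmu fmu e0; pose E := e `^ p; have E0 : 0 < E by exact: powR_gt0.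
pose B := 2 `^ p * (2 * M) `^ p.
have B0 : 0 < B by rewrite mulr_gt0 ?powR_gt0 ?mulr_gt0.
have [|r tail] := integral_growth_tail _ dist_metric dist_proper p x0 mu (E / (4 * B)) p_ge0 Ppmu.
  by apply: divr_gt0 => //; exact: mulr_gt0.
have [||A A0 cost] := push_cost_bound _ dist_metric dist_proper f x0 p M r%:R (E / 4) f_continuous p_gt0 M0 fM.
  by [].
  by rewrite divr_gt0.
have EA0 : 0 < E / (4 * A) by apply: divr_gt0 => //; exact: mulr_gt0.
(* Chosen so that a coupling of cost below [d ^ p] makes the term with factor [A] less than
   [E / 4]. *)
exists ((E / (4 * A)) `^ p^-1) => [|nu nu' fnu]; first exact: powR_gt0.
move=> /wasserstein_ltP[]//; first exact: powR_gt0.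
move=> pi cpi; rewrite powRK ?(ltW EA0)// => pid.
have [pi' cpi' pi'E] := coupling_push _ f _ _ _ _ _ f_continuous cpi fmu fnu.
apply/wasserstein_ltP => //; exists pi' => //.
have mff : measurable_fun [set: Borel dist * Borel dist]
    (fun z : Borel dist * Borel dist => (f z.1 : Borel dist, f z.2 : Borel dist)).
  apply: measurable_fun_pair; first exact: (measurableT_comp mf measurable_fst).
  exact: (measurableT_comp mf measurable_snd).
rewrite (ge0_integral_push _ _ _ _ _ _ pi pi' _ mff) =>
  [|C _||y]; last 3 first.
- exact: pi'E.
- exact/measurable_EFinP.
- by rewrite lee_fin powR_ge0.
pose h (x : Borel dist) : R :=
  (1 + dist x x0) `^ p * \1_[set y : Borel dist | r%:R < dist y x0] x.
have h0 x : 0 <= h x by rewrite mulr_ge0 ?powR_ge0.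
have mh : measurable_fun [set: Borel dist] h by exact: measurable_growth_tail.
have mh1 : measurable_fun [set: Borel dist * Borel dist] (fun z => h z.1).
  exact: (measurableT_comp mh measurable_fst).
apply: (@le_lt_trans _ _ (\int[pi]_z (E / 4 + A * dist z.1 z.2 `^ p + B * h z.1)%:E)%E).
  apply: ge0_le_integral => //.
  - by move=> z _; rewrite lee_fin powR_ge0.
  - apply: (measurableT_comp _ mff (f := fun z : Borel dist * Borel dist => (dist z.1 z.2 `^ p)%:E)).
    exact/measurable_EFinP.
  - apply/measurable_EFinP; apply: measurable_funD; last exact: measurable_funM.
    by apply: measurable_funD => //; exact: measurable_funM.
  - by move=> z _; rewrite lee_fin; exact: cost.
rewrite integral_comb ?(ltW A0) ?(ltW B0) ?divr_ge0 ?(ltW E0)//; last first.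
  by move=> z; rewrite powR_ge0.
(* The tail depends on the first coordinate only, so its integral is taken over the first marginal
   [mu], whatever [nu] is. *)
have -> : (\int[pi]_z (h z.1)%:E = \int[mu]_x (h x)%:E)%E.
  apply/esym; apply: (ge0_integral_push _ _ _ _ _ _ pi mu (EFin \o h) measurable_fst).
  - by move=> C mC; case: cpi => /(_ C mC) ->.
  - exact/measurable_EFinP.
  - by move=> x; rewrite /= lee_fin.
have I0 : (0 <= \int[pi]_z (dist z.1 z.2 `^ p)%:E)%E.
  by apply: integral_ge0 => z _; rewrite lee_fin powR_ge0.
have J0 : (0 <= \int[mu]_x (h x)%:E)%E by apply: integral_ge0 => z _; rewrite lee_fin.
rewrite -/(h _) in tail.
move: tail pid I0 J0.
case: (\int[mu]_x (h x)%:E)%E => [J| |]//; case: (\int[pi]_z _)%E => [I| |]//.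
move=> tail pid _ _; rewrite -!EFinM -!EFinD; move: tail pid.
rewrite !lte_fin => tail pid; rewrite -/E.
have BJ : B * J < E / 4 by rewrite -ltr_pdivlMl// mulrC -mulrA -invfM.
have AI : A * I < E / 4 by rewrite -ltr_pdivlMl// mulrC -mulrA -invfM.
lra.
Qed.

(** Here [nu] is the mixture of the Dirac masses at [x0] and [x] with weights [1 - t] and [t], built
    as the image of a Bernoulli law; [pi] is the image under [b |-> (x0, g b)]. The mass at [x] is
    only bounded below because [x] may equal [x0]. *)
Lemma two_point_coupling (x : X) t : 0 <= t <= 1 ->
  exists nu : probability (Borel dist) R, exists pi,
  [/\ coupling (\d_(x0 : Borel dist)) nu pi,
      (\int[pi]_z (dist z.1 z.2 `^ p)%:E = (t * dist x0 x `^ p)%:E)%E,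
      Pp p x0 nu & (t%:E <= nu [set x])%E].
Proof.
move=> t01; pose g (b : bool) : Borel dist := if b then x else x0.
have mg : measurable_fun [set: bool] g by [].
have mxg : measurable_fun [set: bool] (fun b => (x0 : Borel dist, g b)) by [].
have [nu nuE] := exists_push _ _ _ _ _ _ (bernoulli_prob t : probability bool R) mg.
have [pi piE] := exists_push _ _ _ _ _ _ (bernoulli_prob t : probability bool R) mxg.
exists nu, pi; split.
- split=> A mA; last by rewrite piE nuE.
  rewrite piE [RHS]diracE; have [xA|xA] := boolP (x0 \in A).
    rewrite (_ : _ @^-1` _ = setT) ?probability_setT//.
    by apply/seteqP; split=> // b _ /=; rewrite inE in xA.
  rewrite (_ : _ @^-1` _ = set0) ?measure0//.
  by apply/seteqP; split=> // b /=; rewrite notin_setE in xA.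
- rewrite (ge0_integral_push _ _ _ _ _ _ (bernoulli_prob t : probability bool R) pi _ mxg) =>
  [|A _||y]; last 3 first.
  + exact: piE.
  + exact/measurable_EFinP.
  + by rewrite lee_fin powR_ge0.
  rewrite integral_bernoulli_prob//= => [|b]; last by rewrite lee_fin powR_ge0.
  by rewrite distxx powR0 ?gt_eqF// mule0 adde0 EFinM.
- rewrite /Pp (ge0_integral_push _ _ _ _ _ _ (bernoulli_prob t : probability bool R) nu _ mg) =>
  [|A _||y]; last 3 first.
  + exact: nuE.
  + exact/measurable_EFinP.
  + by rewrite lee_fin powR_ge0.
  rewrite integral_bernoulli_prob//= => [|b]; last by rewrite lee_fin powR_ge0.
  by rewrite -!EFinM -EFinD ltry.
have mx := measurable_point _ dist_metric x.
have := integral_indic nu measurableT mx; rewrite setIT => <-.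
rewrite (ge0_integral_push _ _ _ _ _ _ (bernoulli_prob t : probability bool R) nu _ mg) =>
  [|A _||y]; last 3 first.
+ exact: nuE.
+ by apply/measurable_EFinP; exact: measurable_indic.
+ by rewrite lee_fin.
rewrite integral_bernoulli_prob//=.
rewrite indicE mem_set// mule1 leeDl// mule_ge0// lee_fin ?subr_ge0//.
by case/andP: t01.
Qed.

(** A coupling whose first marginal is the Dirac mass at [a] is concentrated on first coordinate
    [a]. It therefore gives the point [(a, y)] mass at least [t], and the cost on that point alone
    is the stated bound. *)
Lemma dirac_cost_ge (a y : X) t (nu : probability (Borel dist) R) pi :
  coupling (\d_(a : Borel dist)) nu pi -> (t%:E <= nu [set y])%E ->
  ((t * dist a y `^ p)%:E <= \int[pi]_z (dist z.1 z.2 `^ p)%:E)%E.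
Proof.
move=> [pi1 pi2] tnu.
have ma := measurable_point _ dist_metric a.
have my := measurable_point _ dist_metric y.
have mfst A : measurable A -> measurable (fst @^-1` A : set (Borel dist * Borel dist)).
  by move=> mA; rewrite -[X in measurable X]setTI; exact: measurable_fst.
have msnd A : measurable A -> measurable (snd @^-1` A : set (Borel dist * Borel dist)).
  by move=> mA; rewrite -[X in measurable X]setTI; exact: measurable_snd.
pose S : set (Borel dist * Borel dist) := fst @^-1` [set a] `&` snd @^-1` [set y].
have mS : measurable S by apply: measurableI; [exact: mfst|exact: msnd].
have tS : (t%:E <= pi S)%E.
  apply: (le_trans tnu); rewrite -pi2//.
  (* Adding the null event that the first coordinate differs from [a] turns [S] into a set
     containing all pairs with second coordinate [y]. *)
  have <- : (pi S + pi (fst @^-1` ~` [set a]) = pi S)%E.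
    rewrite pi1; last exact: measurableC.
    rewrite [X in (_ + X)%E]diracE.
    by rewrite memNset ?adde0// => /(_ erefl).
  apply: (@le_trans _ _ (pi (S `|` fst @^-1` ~` [set a]))); last first.
    by apply: measureU2 => //; apply: mfst; exact: measurableC.
  apply: le_measure; rewrite ?inE//.
  - exact: msnd.
  - by apply: measurableU => //; apply: mfst; exact: measurableC.
  - move=> [u v] /= ->; rewrite /S /=.
    by have [->|ua] := pselect (u = a); [left|right].
apply: (@le_trans _ _ (\int[pi]_z ((dist a y `^ p)%:E * (\1_S z)%:E))%E); last first.
  apply: ge0_le_integral => //.
  - by move=> z _; rewrite -EFinM lee_fin mulr_ge0 ?powR_ge0.
  - by apply/measurable_EFinP; apply: measurable_funM => //; exact: measurable_indic.
  - exact/measurable_EFinP.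
  - move=> [u v] _ /=; rewrite -EFinM lee_fin indicE.
    have [|_] := boolP (_ \in _); last by rewrite mulr0 powR_ge0.
    by rewrite inE => -[/= -> ->]; rewrite mulr1.
rewrite ge0_integralZl_EFin ?powR_ge0//; last first.
  by apply/measurable_EFinP; exact: measurable_indic.
rewrite integral_indic// setIT EFinM muleC.
by apply: lee_wpmul2l => //; rewrite lee_fin powR_ge0.
Qed.

Lemma growth_of_push_continuous : push_Pp_continuous dist p x0 f ->
  exists M, forall x, dist (f x) x0 / (1 + dist x x0) <= M.
Proof.
move=> [_ cont].
have Ppx0 : Pp p x0 (\d_(x0 : Borel dist) : probability (Borel dist) R).
  rewrite /Pp integral_dirac//; last exact/measurable_EFinP.
  by rewrite diracT mul1e ltry.
have pushx0 : is_push f (\d_(x0 : Borel dist) : probability (Borel dist) R)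
    (\d_(f x0 : Borel dist) : probability (Borel dist) R).
  by move=> A mA; rewrite [LHS]diracE [RHS]diracE.
have [d d0 dP] := cont _ _ Ppx0 pushx0 1 ltr01.
(* Halving makes [c] strictly smaller than [d]; the minimum with [1] keeps the transported mass
   [s ^ p] below [1]. *)
pose c := Num.min d 1 / 2.
have [c0 c1 cd] : [/\ 0 < c, c <= 1 & c < d].
  rewrite /c; have : 0 < Num.min d 1 by rewrite lt_min d0 ltr01.
  have : Num.min d 1 <= d by rewrite ge_min lexx.
  have : Num.min d 1 <= 1 by rewrite ge_min lexx orbT.
  by move: (Num.min d 1) => m; split; lra.
(* By the triangle inequality through [f x0], it suffices that [dist (f x0) (f x) <= c^-1 * (1 +
   dist x x0)]. *)
exists (c^-1 + dist (f x0) x0) => x.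
have D1 : 1 <= 1 + dist x x0 by rewrite lerDl.
have D0 : 0 < 1 + dist x x0 by exact: lt_le_trans D1.
(* Moving mass [s ^ p] from [x0] to [x] costs [(s * dist x0 x) ^ p], and [s * dist x0 x <= c < d]
   for every [x]. *)
pose s := c / (1 + dist x x0).
have s0 : 0 < s by rewrite divr_gt0.
have s1 : s <= 1 by rewrite ler_pdivrMr// mul1r (le_trans c1).
have t01 : 0 <= s `^ p <= 1.
  rewrite powR_ge0/=; have := powR_le_mono _ p _ _ p_ge0 (ltW s0) s1.
  by rewrite powR1.
have [nu [pi [cpi costpi Ppnu nux]]] := two_point_coupling x _ t01.
have [nu' nu'E] := exists_push _ _ _ _ _ _ nu mf.
have pushnu : is_push f nu nu' by move=> A _; rewrite nu'E.
have W : (wasserstein p (\d_(x0 : Borel dist) : probability (Borel dist) R) nu < d%:E)%E.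
  apply/wasserstein_ltP => //; exists pi => //; rewrite costpi lte_fin.
  rewrite -powRM ?(ltW s0)//; apply: gt0_ltr_powR; rewrite ?nnegrE ?(ltW d0)//.
    by apply: mulr_ge0 => //; exact: ltW.
  apply: le_lt_trans cd; rewrite /s mulrAC ler_pdivrMr// ler_pM2l// (dist_sym x0).
  by rewrite lerDr.
have [pi' cpi'] := (wasserstein_ltP _ p 1 _ _ p_gt0 ltr01).1 (dP nu nu' Ppnu pushnu W).
(* If the growth bound failed at [x], then [s * dist (f x0) (f x)] would be at least [1], and so
   would the cost of every coupling of the images, contrary to the choice of [d]. *)
rewrite powR1; apply: contraPP => /negP; rewrite -ltNge => Mlt.
apply/negP; rewrite -leNgt.
apply: le_trans (dirac_cost_ge (f x0) (f x) (s `^ p) nu' pi' cpi' _); last first.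
  rewrite nu'E; apply: (le_trans nux); apply: le_measure; rewrite ?inE.
  - exact: measurable_point.
  - rewrite -[X in measurable X]setTI; apply: mf => //; exact: measurable_point.
  - by move=> _ ->.
rewrite lee_fin -powRM ?(ltW s0)//.
have <- : 1 `^ p = 1 :> R by rewrite powR1.
apply: powR_le_mono => //.
rewrite /s mulrAC ler_pdivlMr// mul1r.
have := dist_tri (f x0) (f x) x0; rewrite (dist_sym (f x) (f x0)).
move: Mlt; rewrite ltr_pdivlMr// mulrDl => Mlt tri.
have : dist (f x0) x0 <= dist (f x0) x0 * (1 + dist x x0) by rewrite ler_peMr.
move=> le1; have : c^-1 * (1 + dist x x0) <= dist (f x0) (f x) by lra.
by rewrite ler_pdivrMl// mulrC.
Qed.

End PushForward.

Theorem mainTheorem5 (R : realType) (X : pointedType) (dist : X -> X -> R)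
  (f : X -> X) (x0 : X) (p : R) :
  is_metric dist -> proper_space dist -> mcontinuous dist f -> 1 <= p ->
  (push_Pp_continuous dist p x0 f <->
   exists M : R, forall x : X, dist (f x) x0 / (1 + dist x x0) <= M).
Proof.
move=> dist_metric dist_proper cf p1; split; first exact: growth_of_push_continuous.
(* The maximum with [1] provides the positive growth constant used by the estimates. *)
move=> [M0 fM0]; pose M := Num.max M0 1.
have M_gt0 : 0 < M by rewrite lt_max ltr01 orbT.
have fM x : dist (f x) x0 <= M * (1 + dist x x0).
  have D0 : 0 < 1 + dist x x0 by case: dist_metric => d0 _ _ _; have := d0 x x0; lra.
  by rewrite -ler_pdivrMr// (le_trans (fM0 x))// le_max lexx.
split=> [mu|mu mu' Ppmu fmu e e0].
  exact: (push_Pp dist dist_metric dist_proper f x0 p cf p1 M).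
have [d d0 dP] := push_wasserstein_continuous dist dist_metric dist_proper
  f x0 p cf p1 M mu mu' e M_gt0 fM Ppmu fmu e0.
by exists d => // nu nu' _; exact: dP.
Qed.
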